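(* Let $f,g:2^V\to\mathbb{R}$ be submodular functions on a finite ground set $V$ and let $v(X)=f(X)-g(X)$. Consider the supermodular-submodular (SupSub) procedure for minimizing $v$ described in the context, in either of its two variants (parallel or alternating), and let $X^0=\emptyset,X^1,X^2,\dots$ be the sets it produces. (1) Both variants monotonically reduce the objective value at every iteration: $v(X^{t+1})\le v(X^t)$ for every $t$. (2) Moreover, assume that the submodular maximization procedure used to carry out the inner optimization step reaches a local minimum of $X\mapsto m^f_{X^t}(X)-g(X)$ (equivalently, a local maximum of the submodular function $g-m^f_{X^t}$). Then, if the SupSub procedure does not improve under both modular upper bounds (that is, at the current set $X^t$ the objective value does not decrease in an iteration, neither with $m^f_{X^t}=m^f_{X^t,1}$ nor with $m^f_{X^t}=m^f_{X^t,2}$), it has reached a local optimum of $v$: $X^t$ is a local minimum of $v$.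
   Context: A set function $f:2^V\to\mathbb{R}$ is submodular if $f(S)+f(T)\ge f(S\cup T)+f(S\cap T)$ for all $S,T\subseteq V$. Write $f(A|B)=f(A\cup B)-f(B)$, and $j$ for $\{j\}$. For submodular $f$ and a set $X\subseteq V$ define the two modular upper bounds (each satisfies $f(Y)\le m^f_{X,i}(Y)$ for all $Y\subseteq V$, with equality at $Y=X$): $$m^f_{X,1}(Y)=f(X)-\sum_{j\in X\setminus Y}f(j|X\setminus j)+\sum_{j\in Y\setminus X}f(j|\emptyset),$$ $$m^f_{X,2}(Y)=f(X)-\sum_{j\in X\setminus Y}f(j|V\setminus j)+\sum_{j\in Y\setminus X}f(j|X).$$ $m^f_X$ denotes either one. A set $X$ is a local minimum of a set function $w$ if $w(X)\le w(X\cup j)$ for all $j\in V\setminus X$ and $w(X)\le w(X\setminus j)$ for all $j\in X$; local maxima are defined analogously. SupSub procedure: start with $X^0=\emptyset$. At iteration $t$, the next set $X^{t+1}$ is computed by (possibly approximately) minimizing $m^f_{X^t}(X)-g(X)$ over $X\subseteq V$, i.e. by submodular maximization of $g-m^f_{X^t}$, where $m^f_{X^t}$ is one of $m^f_{X^t,1},m^f_{X^t,2}$. In the parallel variant, this is done with both bounds and the result with the smaller function value is taken; in the alternating variant, the two bounds are used alternately. Since the optimization may be only approximate, the next step is taken only if the objective $v$ does not increase. The procedure stops when $X^{t+1}=X^t$.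
   Formalization: In (2) it is also assumed that each inner optimization proceeds from X^t: the local minimum it returns is X^t itself, or has a strictly smaller value of m^f_{X^t}-g than X^t, or is an exact minimizer; for arbitrary local minima the claim is false. *)

(* Defs.v *)
From mathcomp Require Import all_boot all_order all_algebra.

Set Implicit Arguments.
Unset Strict Implicit.
Unset Printing Implicit Defensive.

Import Order.TTheory GRing.Theory Num.Theory.
Local Open Scope ring_scope.

Section SupSub.

Variables (R : realFieldType) (V : finType).

Definition submodular (f : {set V} -> R) :=
  forall S T : {set V}, f (S :|: T) + f (S :&: T) <= f S + f T.

(* f(j | B) *)
Definition gain (f : {set V} -> R) (j : V) (B : {set V}) : R :=
  f (j |: B) - f B.

Definition local_min (w : {set V} -> R) (X : {set V}) :=
  (forall j, j \notin X -> w X <= w (j |: X)) /\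
  (forall j, j \in X -> w X <= w (X :\ j)).

Inductive bound := UB1 | UB2.

Definition other (k : bound) := if k is UB1 then UB2 else UB1.

Definition modular_ub (f : {set V} -> R) (k : bound) (X Y : {set V}) : R :=
  match k with
  | UB1 => f X - \sum_(j in X :\: Y) gain f j (X :\ j)
               + \sum_(j in Y :\: X) gain f j set0
  | UB2 => f X - \sum_(j in X :\: Y) gain f j ([set: V] :\ j)
               + \sum_(j in Y :\: X) gain f j X
  end.

Definition objective (f g : {set V} -> R) (X : {set V}) : R := f X - g X.

(* m^f_X - g, the function minimized by the inner optimization at X *)
Definition surrogate (f g : {set V} -> R) (k : bound) (X Y : {set V}) : R :=
  modular_ub f k X Y - g Y.

(* [opt t k X] is the set returned at iteration [t] by the inner optimization
   of [surrogate f g k X]. Nothing is assumed about its quality; it may depend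
   on [t], so that randomized procedures are covered. *)
Definition inner_procedure := nat -> bound -> {set V} -> {set V}.

(* A candidate Y replaces the current set X only if v does not increase. *)
Definition accept (v : {set V} -> R) (X Y : {set V}) : {set V} :=
  if v Y <= v X then Y else X.

Inductive variant := Parallel | Alternating.

(* Runs are infinite sequences, without the stopping test X^(t+1) = X^t: the
   stopped procedure produces an initial segment of such a sequence, and
   statements about every t apply to it. (In the alternating variant, stopping
   at the first repetition would try only one of the two bounds.)
   Ties between the two parallel candidates are broken arbitrarily, and the
   alternation may start with either bound. *)
Definition supsub_run (f g : {set V} -> R) (opt : inner_procedure)
    (var : variant) (X : nat -> {set V}) :=
  let v := objective f g in
  X 0%N = set0 /\
  match var with
  | Parallel => forall t, exists2 k,
      forall l, v (opt t k (X t)) <= v (opt t l (X t)) &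
      X t.+1 = accept v (X t) (opt t k (X t))
  | Alternating => exists k0, forall t,
      X t.+1 = accept v (X t) (opt t (iter t other k0) (X t))
  end.

(* The inner minimization of w proceeds from the current set A: unless it
   minimizes w exactly, it leaves A only for a set B with a smaller value.
   Without this, an inner optimization returning local minima of the surrogate
   can miss every improvement: take V = {a,b}, f = 0, g{b} = 1 and g = 0
   elsewhere. At X^0 = set0 the local minimum {a} of -g does not improve v,
   whereas {b} does. *)
Definition descends_from (w : {set V} -> R) (A B : {set V}) :=
  [\/ B = A, w B < w A | forall Z, w B <= w Z].

(* With either bound, an iteration carried out at the set X^t does not decrease
   v. The alternating variant tries the two bounds at different iterations s,
   at the same set X^s = X^t; in the parallel variant s = t. *)
Definition no_improvement (f g : {set V} -> R) (opt : inner_procedure)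
    (X : nat -> {set V}) (t : nat) :=
  let v := objective f g in
  forall k, exists2 s,
    X s = X t & v (X s) <= v (accept v (X s) (opt s k (X s))).

End SupSub.

(* Main.v *)
Require Import Defs.
From mathcomp Require Import all_boot all_order all_algebra.
From mathcomp Require Import lra.

(** Since both surrogates dominate [v] and agree with it at [X^t], an iteration
    that does not improve [v] cannot strictly decrease the surrogate, so [X^t] is
    itself a local minimum of both surrogates. The first surrogate coincides with
    [v] at all sets [X^t :\ j], the second one at all sets [j |: X^t], so together
    they control every neighbour of [X^t]. *)

Import Order.TTheory GRing.Theory Num.Theory.
Local Open Scope ring_scope.

Section ModularBounds.

Variables (R : realFieldType) (V : finType).
Implicit Types (f g : {set V} -> R) (A B C D X Y : {set V}).

Lemma submodular_gain f A B j :
  submodular f -> A \subset B -> j \notin B -> gain f j B <= gain f j A.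
Proof.
(* The union of [j |: A] and [B] is [j |: B], and since [j] is outside [B] their intersection is
   [A]. *)
move=> sub_f sAB jB; have := sub_f (j |: A) B.
rewrite -setUA (setUidPr sAB) setIUl (setIidPl sAB).
have -> : [set j] :&: B = set0.
  by apply/eqP; rewrite setI_eq0 disjoints1.
rewrite set0U /gain; lra.
Qed.

(** The elements of [D] are added to [A] one at a time. Each intermediate set lies between [A] and
    [A :|: D], so [h j] pays for the step that adds [j], in whatever order. *)
Lemma setU_le_sum f (h : V -> R) A D :
  [disjoint A & D] ->
  (forall j B, j \in D -> A \subset B -> B \subset A :|: D -> j \notin B ->
     gain f j B <= h j) ->
  f (A :|: D) <= f A + \sum_(j in D) h j.
Proof.
elim: {D}#|D| {-2}D (leqnn #|D|) => [|n IHn] D leDn dAD hD.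
  have -> : D = set0 by apply/eqP; rewrite -cards_eq0 -leqn0.
  by rewrite setU0 big_set0 addr0.
have [->|[j jD]] := set_0Vmem D; first by rewrite setU0 big_set0 addr0.
have jA : j \notin A by rewrite (disjointFl dAD jD).
have sDjD : D :\ j \subset D by apply: subD1set.
have leAD : f (A :|: D :\ j) <= f A + \sum_(i in D :\ j) h i.
  apply: IHn => [||i B iD sAB sBD iB].
  - by rewrite (cardsD1 j) jD in leDn.
  - exact: disjointWr sDjD dAD.
  - apply: hD => //; first exact: (subsetP sDjD).
    exact: subset_trans sBD (setUS _ sDjD).
have := hD j (A :|: D :\ j) jD (subsetUl _ _) (setUS _ sDjD).
rewrite !inE eqxx (negPf jA) /= => /(_ isT).
rewrite /gain setUCA setD1K // (big_setD1 j jD) /=; lra.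
Qed.

Lemma setU_ge_sum f (h : V -> R) A D :
  [disjoint A & D] ->
  (forall j B, j \in D -> A \subset B -> B \subset A :|: D -> j \notin B ->
     h j <= gain f j B) ->
  f A + \sum_(j in D) h j <= f (A :|: D).
Proof.
move=> dAD hD.
(* Negating [f] and [h] turns lower bounds on gains into upper bounds. *)
have := @setU_le_sum (fun B => - f B) (fun j => - h j) A D dAD.
rewrite sumrN => le; suff: - f (A :|: D) <= - f A - \sum_(j in D) h j by lra.
apply: le => j B jD sAB sBD jB; have := hD j B jD sAB sBD jB.
rewrite /gain; lra.
Qed.

Lemma submodular_setU_le f A C D :
  submodular f -> [disjoint A & D] -> C \subset A ->
  f (A :|: D) <= f A + \sum_(j in D) gain f j C.
Proof.
move=> sub_f dAD sCA; apply: setU_le_sum => // j B _ sAB _ jB.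
exact: submodular_gain (subset_trans sCA sAB) jB.
Qed.

(** Every intermediate set that omits [j] is contained in [C :\ j], where by diminishing returns the
    gain of [j] is smallest. *)
Lemma submodular_setU_ge f A C D :
  submodular f -> [disjoint A & D] -> A :|: D \subset C ->
  f A + \sum_(j in D) gain f j (C :\ j) <= f (A :|: D).
Proof.
move=> sub_f dAD sADC; apply: setU_ge_sum => // j B _ _ sBD jB.
apply: submodular_gain => //; last by rewrite !inE eqxx.
by rewrite subsetD1 jB (subset_trans sBD sADC).
Qed.

Lemma modular_ub_ge f k X Y : submodular f -> f Y <= modular_ub f k X Y.
Proof.
move=> sub_f; case: k => /=.
(* The first bound goes from [X] to [Y] through [X :&: Y]: first remove [X :\: Y], then add
   [Y :\: X]. *)
- have dIY : [disjoint X :&: Y & Y :\: X].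
    by rewrite -setI_eq0; apply/eqP/setP=> x; rewrite !inE; do 2!case: (_ \in _).
  have dIX : [disjoint X :&: Y & X :\: Y].
    by rewrite -setI_eq0; apply/eqP/setP=> x; rewrite !inE; do 2!case: (_ \in _).
  have := @submodular_setU_le f _ set0 _ sub_f dIY (sub0set _).
  have := @submodular_setU_ge f _ X _ sub_f dIX.
  rewrite setID [X :&: Y]setIC setID => /(_ (subxx _)); lra.
(* The second bound goes through [X :|: Y]: first add [Y :\: X], then remove [X :\: Y]. *)
- have dXY : [disjoint X & Y :\: X].
    by rewrite -setI_eq0 setIC setIDAC setDIl setDv setI0.
  have dYX : [disjoint Y & X :\: Y].
    by rewrite -setI_eq0 setIC setIDAC setDIl setDv setI0.
  have := @submodular_setU_le f _ X _ sub_f dXY (subxx _).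
  have := @submodular_setU_ge f _ [set: V] _ sub_f dYX (subsetT _).
  have setUDK A B : A :|: B :\: A = A :|: B.
    by apply/setP=> x; rewrite !inE; case: (x \in A).
  rewrite !setUDK [Y :|: X]setUC; lra.
Qed.

Lemma modular_ub_id f k X : modular_ub f k X X = f X.
Proof. by case: k; rewrite /= setDv !big_set0 subr0 addr0. Qed.

Lemma modular_ub1_setD1 f X j :
  j \in X -> modular_ub f UB1 X (X :\ j) = f (X :\ j).
Proof.
move=> jX /=.
have -> : X :\: (X :\ j) = [set j].
  by rewrite setDDr setDv set0U; apply/setIidPr; rewrite sub1set.
have -> : (X :\ j) :\: X = set0 by apply/eqP; rewrite setD_eq0 subD1set.
rewrite big_set1 big_set0 /gain setD1K //; lra.
Qed.

Lemma modular_ub2_setU1 f X j :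
  j \notin X -> modular_ub f UB2 X (j |: X) = f (j |: X).
Proof.
move=> jX /=.
have -> : X :\: (j |: X) = set0 by apply/eqP; rewrite setD_eq0 subsetUr.
have -> : (j |: X) :\: X = [set j].
  by rewrite setDUl setDv setU0; apply/setDidPl; rewrite disjoints1.
rewrite big_set1 big_set0 /gain; lra.
Qed.

Lemma surrogate_ge f g k X Y :
  submodular f -> objective f g Y <= surrogate f g k X Y.
Proof. by move=> sub_f; rewrite lerB ?modular_ub_ge. Qed.

Lemma surrogate_id f g k X : surrogate f g k X X = objective f g X.
Proof. by rewrite /surrogate modular_ub_id. Qed.

Lemma accept_le (v : {set V} -> R) X Y : v (accept v X Y) <= v X.
Proof. by rewrite /accept; case: ifP. Qed.

Lemma le_accept (v : {set V} -> R) X Y : v X <= v (accept v X Y) -> v X <= v Y.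
Proof.
by rewrite /accept; case: ifPn => //; rewrite -ltNge => lt _; apply: ltW.
Qed.

Lemma descends_local_min f g k X B :
  submodular f -> local_min (surrogate f g k X) B ->
  descends_from (surrogate f g k X) X B ->
  objective f g X <= objective f g B -> local_min (surrogate f g k X) X.
Proof.
move=> sub_f minB desc leXB.
have leB := surrogate_ge f g k X B sub_f.
case: desc => [eBX|ltB|gminB]; first by rewrite eBX in minB.
(* A strict descent is contradictory: the surrogate at [B] would lie below [v X], hence below [v B],
   which it dominates. *)
- by rewrite surrogate_id in ltB; lra.
(* If [B] is a global minimizer, the surrogate at [X] equals [v X], at most [v B] and so at most the
   minimum: [X] is a global minimizer too. *)
- have minX Z : surrogate f g k X X <= surrogate f g k X Z.
    by rewrite surrogate_id (le_trans leXB) // (le_trans leB).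
  by split=> j _.
Qed.

Lemma surrogates_local_min f g X :
  (forall k, local_min (surrogate f g k X) X) -> local_min (objective f g) X.
Proof.
move=> minX; split=> j jX.
- have [/(_ j jX) + _] := minX UB2.
  by rewrite surrogate_id /surrogate modular_ub2_setU1.
- have [_ /(_ j jX)] := minX UB1.
  by rewrite surrogate_id /surrogate modular_ub1_setD1.
Qed.

End ModularBounds.

Theorem theorem4p1 (R : realFieldType) (V : finType) (f g : {set V} -> R)
    (opt : inner_procedure V) (var : variant) (X : nat -> {set V}) :
  submodular f -> submodular g -> supsub_run f g opt var X ->
  (forall t, objective f g (X t.+1) <= objective f g (X t)) /\
  ((forall t k, local_min (surrogate f g k (X t)) (opt t k (X t))) ->
   (forall t k, descends_from (surrogate f g k (X t)) (X t) (opt t k (X t))) ->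
   forall t, no_improvement f g opt X t -> local_min (objective f g) (X t)).
Proof.
move=> sub_f _ [_ run]; split=> [t|minO descO t noimp].
  case: var run => [/(_ t)[k _ ->]|[k0 /(_ t) ->]]; exact: accept_le.
(* Bound [k] may have been tried at another iteration [s]. The surrogate depends only on the current
   set, so [X s = X t] carries the conclusion over to [t]. *)
apply: surrogates_local_min => k; have [s eXs /le_accept leXB] := noimp k.
rewrite -eXs; exact: descends_local_min (minO s k) (descO s k) leXB.
Qed.
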